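(* Let $(X,d)$ be an asymptotically $\mathrm{PT}_{-1}$ metric space. Then $X$ is a boundary continuous Gromov hyperbolic space. For every basepoint $o\in X$, the function $\rho_o(x,y)=e^{-(x|y)_o}$ (with $e^{-\infty}=0$) defines a metric on $\partial_\infty X$. For different basepoints $o,o'\in X$ the metrics $\rho_o,\rho_{o'}$ are Möbius equivalent, and thus (when $\partial_\infty X$ has at least two points) they define a canonical Möbius structure $\mathcal{M}$ on $\partial_\infty X$, namely the Möbius equivalence class of $\rho_o$. The Möbius structure $\mathcal{M}$ is complete and ptolemaic.
   Context: **Asymptotically $\mathrm{PT}_{-1}$.** A metric space $(X,d)$ is asymptotically $\mathrm{PT}_{-1}$ if there exists $\delta>0$ such that for all $x_1,x_2,x_3,x_4\in X$, with $\rho_{i,j}=d(x_i,x_j)$ and $\rho=\max_{i,j}\rho_{i,j}$, $$e^{\frac12(\rho_{1,3}+\rho_{2,4})}\le e^{\frac12(\rho_{1,2}+\rho_{3,4})}+e^{\frac12(\rho_{1,4}+\rho_{2,3})}+\delta e^{\frac12\rho}.$$ **Gromov hyperbolicity and boundary.** $X$ is Gromov hyperbolic if there is $\delta>0$ with $\rho_{1,3}+\rho_{2,4}\le\max\{\rho_{1,2}+\rho_{3,4},\rho_{1,4}+\rho_{2,3}\}+\delta$ for all quadruples. The Gromov product is $(x|y)_o=\frac12(d(o,x)+d(o,y)-d(x,y))$. A sequence $(x_i)$ in $X$ converges at infinity if $\lim_{i,j\to\infty}(x_i|x_j)_o=\infty$ for some (hence every) $o\in X$. Two such sequences are equivalent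 if $\lim_i(x_i|y_i)_o=\infty$. $\partial_\infty X$ is the set of equivalence classes; $(x_i)$ converges to $\xi\in\partial_\infty X$ if it converges at infinity and belongs to the class $\xi$. For $\zeta,\xi\in\partial_\infty X$, $(\zeta|\xi)_o=\inf\liminf_{i\to\infty}(x_i|y_i)_o$, infimum over all $(x_i)\in\zeta$, $(y_i)\in\xi$; similarly, for $x\in X$, $(x|\xi)_o=\inf\liminf_i (x|y_i)_o$ over $(y_i)\in\xi$. $X$ is boundary continuous if, whenever $(x_i),(y_i)$ are sequences in $X$ converging to points $\bar x,\bar y$ in $X$ or $\partial_\infty X$, one has $(x_i|y_i)_o\to(\bar x|\bar y)_o$ for all $o\in X$. **Möbius structures.** Let $Z$ be a set with at least two points. An extended metric on $Z$ is a map $d:Z\times Z\to[0,\infty]$ for which there is a set $\Omega(d)\subset Z$ of cardinality $0$ or $1$ such that $d$ restricted to $Z\setminus\Omega(d)$ is a (finite) metric, $d(z,\omega)=\infty$ for $z\in Z\setminus\Omega(d)$, $\omega\in\Omega(d)$, and $d(\omega,\omega)=0$. If $\Omega(d)=\{\omega\}$, $\omega$ is called the point at infinity; write $Z_\omega=Z\setminus\{\omega\}$ (and $Z_\omega=Z$ if $\Omega(d)=\emptyset$). $(Z,d)$ is complete if every Cauchy sequence in $Z_\omega$ converges and, in case $Z_\omega$ is unbounded, the point at infinity exists. A quadruple in $Z^4$ is admissible if no entry occurs three or four times. The cross ratio triple of an admissible quadruple is $$\mathrm{crt}(x,y,z,w)=(d(x,y)d(z,w):d(x,z)d(y,w):d(x,w)d(y,z))\in\mathbb{R}P^2,$$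 with infinite distances cancelled: if $w$ is the point at infinity and the other entries are not, it is $(d(x,y):d(x,z):d(y,z))$; if $z=w$ is the point at infinity it is $(0:1:1)$; analogously for other positions. A map between extended metric spaces is Möbius if it is injective and preserves $\mathrm{crt}$ of all admissible quadruples. Two extended metrics on $Z$ are Möbius equivalent if the identity map between them is Möbius. A Möbius structure on $Z$ is a Möbius equivalence class of extended metrics. It is complete if some (equivalently every) metric in it is complete, and ptolemaic if for some (equivalently every) metric in it the entries $a,b,c$ of $\mathrm{crt}=(a:b:c)$ (taken nonnegative) satisfy the triangle inequalities for all admissible quadruples; for a finite metric this says $d(x,y)d(z,w)\le d(x,z)d(y,w)+d(x,w)d(y,z)$ for all quadruples. *)

(* Defs.v *)
From HB Require Import structures.
From mathcomp Require Import all_boot all_order all_algebra.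
From mathcomp Require Import all_classical all_reals all_analysis.

Set Implicit Arguments.
Unset Strict Implicit.
Unset Printing Implicit Defensive.

Import Order.TTheory GRing.Theory Num.Theory.
Import numFieldNormedType.Exports.

Local Open Scope classical_set_scope.
Local Open Scope ring_scope.

(* The default 0 of the maximum is harmless: distances are nonnegative. *)
Definition asymptotically_PT (R : realType) (X : metricType R) : Prop :=
  exists2 delta : R, 0 < delta & forall x1 x2 x3 x4 : X,
    let rho := \big[Num.max/0]_(r <- [:: mdist x1 x2; mdist x1 x3; mdist x1 x4;
                                         mdist x2 x3; mdist x2 x4; mdist x3 x4]) r in
    expR (2^-1 * (mdist x1 x3 + mdist x2 x4)) <=
      expR (2^-1 * (mdist x1 x2 + mdist x3 x4))
      + expR (2^-1 * (mdist x1 x4 + mdist x2 x3))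
      + delta * expR (2^-1 * rho).

Definition gromov_hyperbolic (R : realType) (X : metricType R) : Prop :=
  exists2 delta : R, 0 < delta & forall x1 x2 x3 x4 : X,
    mdist x1 x3 + mdist x2 x4 <=
      Num.max (mdist x1 x2 + mdist x3 x4) (mdist x1 x4 + mdist x2 x3) + delta.

Section boundary.
Context {R : realType} {X : metricType R}.
Implicit Types (o : X) (x y : nat -> X).

Definition gromov_prod o (p q : X) : R :=
  2^-1 * (mdist o p + mdist o q - mdist p q).

Definition cvg_at_infinity x : Prop :=
  exists o, gromov_prod o (x ij.1) (x ij.2) @[ij --> (\oo, \oo)] --> +oo.

Definition equiv_at_infinity x y : Prop :=
  exists o, gromov_prod o (x i) (y i) @[i --> \oo] --> +oo.

Definition class_at_infinity x : set (nat -> X) :=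
  [set y | cvg_at_infinity y /\ equiv_at_infinity x y].

End boundary.

Definition boundary (R : realType) (X : metricType R) : Type :=
  {xi : set (nat -> X) |
    exists2 x, cvg_at_infinity x & xi = class_at_infinity x}.

Section boundary_theory.
Context {R : realType} {X : metricType R}.
Implicit Types (o : X) (x y : nat -> X) (xi zeta : boundary X).

Local Notation bordification := (X + boundary X)%type.

(* A member of a class converges at infinity by definition of the class. *)
Definition cvg_to_point x (p : bordification) : Prop :=
  match p with
  | inl a => x @ \oo --> a
  | inr xi => sval xi x
  end.

Definition egromov_prod o (p q : bordification) : \bar R :=
  match p, q with
  | inl a, inl b => (gromov_prod o a b)%:E
  | inl a, inr xi =>
      ereal_inf [set limn_einf (fun i => (gromov_prod o a (y i))%:E)
                | y in sval xi]
  | inr xi, inl a =>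
      ereal_inf [set limn_einf (fun i => (gromov_prod o (x i) a)%:E)
                | x in sval xi]
  | inr zeta, inr xi =>
      ereal_inf [set limn_einf (fun i => (gromov_prod o (x i) (y i))%:E)
                | x in sval zeta & y in sval xi]
  end.

(* Values in [\bar R], as for all the (extended) metrics below. *)
Definition visual_metric o xi zeta : \bar R :=
  expeR (- egromov_prod o (inr xi) (inr zeta))%E.

End boundary_theory.

Definition boundary_continuous (R : realType) (X : metricType R) : Prop :=
  forall (x y : nat -> X) (p q : X + boundary X),
    cvg_to_point x p -> cvg_to_point y q ->
    forall o : X,
      (gromov_prod o (x i) (y i))%:E @[i --> \oo] --> egromov_prod o p q.

Definition at_least_two_points (Z : Type) : Prop := exists z w : Z, z <> w.

Section moebius.
Context {R : realType}.
Local Open Scope ereal_scope.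

Definition metric_on (Z : Type) (A : set Z) (d : Z -> Z -> \bar R) : Prop :=
  [/\ forall x y, A x -> A y -> d x y \is a fin_num /\ 0 <= d x y,
      forall x y, A x -> A y -> (d x y = 0 <-> x = y),
      forall x y, A x -> A y -> d x y = d y x &
      forall x y z, A x -> A y -> A z -> d x z <= d x y + d y z].

(* [Omega] is the set, empty or a singleton, of points at infinity of [d]. *)
Definition ext_metric_with (Z : Type) (Omega : set Z) (d : Z -> Z -> \bar R) :
    Prop :=
  [/\ is_subset1 Omega,
      metric_on (~` Omega) d,
      forall z w, ~ Omega z -> Omega w -> d z w = +oo /\ d w z = +oo &
      forall w, Omega w -> d w w = 0].

Definition ext_metric (Z : Type) (d : Z -> Z -> \bar R) : Prop :=
  exists Omega, ext_metric_with Omega d.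

Definition complete_ext_metric (Z : Type) (d : Z -> Z -> \bar R) : Prop :=
  exists2 Omega, ext_metric_with Omega d &
    (forall u : nat -> Z, (forall n, ~ Omega (u n)) ->
       (forall e : R, (0 < e)%R ->
          \forall i \near \oo & j \near \oo, d (u i) (u j) < e%:E) ->
       exists2 l, ~ Omega l & d (u n) l @[n --> \oo] --> 0)
    /\ (~ (exists B : R, forall z w, ~ Omega z -> ~ Omega w -> d z w <= B%:E) ->
        Omega !=set0).

Definition admissible (Z : Type) (x y z w : Z) : Prop :=
  [/\ ~ (x = y /\ y = z), ~ (x = y /\ y = w),
      ~ (x = z /\ z = w) & ~ (y = z /\ z = w)].

Definition cancelled_dist (Z : Type) (d : Z -> Z -> \bar R) (x y : Z) : R :=
  if d x y is r%:E then r else 1%R.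

(* Homogeneous coordinates of the cross ratio triple.  Cancelling infinite
   distances amounts to replacing each of them by 1: if the point at infinity
   is a single entry, each coordinate has exactly one infinite factor; if it is
   two entries, one coordinate has the factor d(omega, omega) = 0 and each of
   the other two is a product of two infinite factors. *)
Definition crt (Z : Type) (d : Z -> Z -> \bar R) (x y z w : Z) : R * R * R :=
  let c := cancelled_dist d in
  (c x y * c z w, c x z * c y w, c x w * c y z)%R.

Definition proj_eq (s t : R * R * R) : Prop :=
  exists2 k : R, (k != 0)%R &
    t = (k * s.1.1, k * s.1.2, k * s.2)%R.

Definition moebius_map (Z Z' : Type) (d : Z -> Z -> \bar R)
    (d' : Z' -> Z' -> \bar R) (f : Z -> Z') : Prop :=
  injective f /\
  forall x y z w, admissible x y z w ->
    proj_eq (crt d x y z w) (crt d' (f x) (f y) (f z) (f w)).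

Definition moebius_equivalent (Z : Type) (d d' : Z -> Z -> \bar R) : Prop :=
  moebius_map d d' idfun.

Definition moebius_class (Z : Type) (d : Z -> Z -> \bar R) :
    set (Z -> Z -> \bar R) :=
  [set d' | ext_metric d' /\ moebius_equivalent d d'].

Definition moebius_structure (Z : Type) (M : set (Z -> Z -> \bar R)) : Prop :=
  at_least_two_points Z /\ exists2 d, ext_metric d & M = moebius_class d.

Definition complete_moebius (Z : Type) (M : set (Z -> Z -> \bar R)) : Prop :=
  exists2 d, M d & complete_ext_metric d.

Definition ptolemaic_ext_metric (Z : Type) (d : Z -> Z -> \bar R) : Prop :=
  forall x y z w, admissible x y z w ->
    let: (a, b, c) := crt d x y z w in
    [/\ (a <= b + c)%R, (b <= a + c)%R & (c <= a + b)%R].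

Definition ptolemaic_moebius (Z : Type) (M : set (Z -> Z -> \bar R)) : Prop :=
  exists2 d, M d & ptolemaic_ext_metric d.

End moebius.

(* Main.v *)
Require Import Defs.
From mathcomp Require Import all_boot all_order all_algebra.
From mathcomp Require Import all_classical all_reals all_analysis.
From mathcomp Require Import ring lra.

(** Write s(x,y) = exp(-(x|y)_o).  Multiplying the asymptotic PT_{-1} inequality
    by exp(-(d(o,x1) + ... + d(o,x4))/2) turns it into the Ptolemy inequality
    for s up to an error made of terms s(xi,xj) exp(-(d(o,xk) + d(o,xl))/2),
    where {i,j,k,l} = {1,2,3,4} ([vis_quad]).

    If one of the points is o, then s(.,o) = 1 and the inequality becomes a
    triangle inequality for s.  Its error is bounded in terms of a single Gromov
    product, which gives the estimate
        |s(x,z) - s(y,z)| <= (1 + delta) exp(-(x|y)_o / 2),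
    uniform in z ([vis_lip_hvis]).  Hence, if (x_i) and (y_i) converge to points
    of the space or of its boundary, s(x_i,y_i) is a Cauchy sequence whose limit
    depends only on these points ([vis_uniform], [vis_cvg_ex]).  This is boundary
    continuity: the infimum of lower limits defining the Gromov product at
    infinity is an actual limit, and the visual metric of two boundary points is
    the limit of s(x_i,y_i) along any representatives ([egromov_prod_spec],
    [bvis_cvg]).

    The properties of the visual metrics then follow by passing to the limit.
    When all the points but o go to infinity the errors vanish, leaving the
    triangle and Ptolemy inequalities ([bvis_triangle], [bvis_ptolemy]).  A change
    of basepoint multiplies s(x,y) by a product of a function of x and a function
    of y ([bvis_change_base]), which does not affect cross ratios.  Completeness
    is a diagonal argument based on the uniform estimate above ([bvis_complete]).
    Finally, hyperbolicity is independent of all this: the largest of the six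
    distances is at most the larger of the two sums of opposite sides
    ([asymptotically_PT_hyperbolic]). *)

Set Implicit Arguments.
Unset Strict Implicit.
Unset Printing Implicit Defensive.

Import Order.TTheory GRing.Theory Num.Theory.
Import numFieldNormedType.Exports.

Local Open Scope classical_set_scope.
Local Open Scope ring_scope.

(** * Gromov hyperbolicity *)

(** The asymptotic PT_{-1} inequality with the constant [delta] made explicit,
    so that it can be fixed throughout the argument. *)
Definition asymptotically_PT_with (R : realType) (X : metricType R)
    (delta : R) : Prop :=
  0 < delta /\ forall x1 x2 x3 x4 : X,
    let rho := \big[Num.max/0]_(r <- [:: mdist x1 x2; mdist x1 x3; mdist x1 x4;
                                         mdist x2 x3; mdist x2 x4; mdist x3 x4]) r in
    expR (2^-1 * (mdist x1 x3 + mdist x2 x4)) <=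
      expR (2^-1 * (mdist x1 x2 + mdist x3 x4))
      + expR (2^-1 * (mdist x1 x4 + mdist x2 x3))
      + delta * expR (2^-1 * rho).

Section hyperbolicity.
Variables (R : realType) (X : metricType R).

Lemma asymptotically_PT_hyperbolic : asymptotically_PT X -> gromov_hyperbolic X.
Proof.
move=> [delta d0 PT]; exists (2 * ln (2 + delta)).
  by rewrite mulr_gt0 ?ln_gt0//; lra.
move=> x1 x2 x3 x4; have := PT x1 x2 x3 x4 => /=.
set rho := \big[_/_]_(_ <- _) _.
set m := Num.max _ _.
have t1 := metric_triangle x1 x2 x3; have t2 := metric_triangle x1 x4 x3.
have t3 := metric_triangle x2 x3 x4; have t4 := metric_triangle x2 x1 x4.
have s1 := metric_sym x4 x3; have s2 := metric_sym x2 x1.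
have am : mdist x1 x2 + mdist x3 x4 <= m by rewrite le_max lexx.
have bm : mdist x1 x4 + mdist x2 x3 <= m by rewrite le_max lexx orbT.
have p12 := mdist_ge0 x1 x2; have p34 := mdist_ge0 x3 x4.
have p14 := mdist_ge0 x1 x4; have p23 := mdist_ge0 x2 x3.
(* Each side of the quadrilateral is at most [m]; adding two triangle
   inequalities bounds twice each diagonal by the sum of the four sides, hence
   by [2 * m]. *)
have rm : rho <= m.
  rewrite /rho !big_cons big_nil !ge_max; do !(apply/andP; split); lra.
have half_le u : u <= m -> expR (2^-1 * u) <= expR (2^-1 * m).
  by move=> um; rewrite ler_expR; lra.
move=> H; have {}H : expR (2^-1 * (mdist x1 x3 + mdist x2 x4)) <=
    (2 + delta) * expR (2^-1 * m).
  apply: (le_trans H); rewrite mulrDl.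
  apply: lerD; last by rewrite ler_pM2l// half_le.
  by rewrite mulr_natl mulr2n; apply: lerD; exact: half_le.
have dp : 0 < 2 + delta by lra.
have E : 2 + delta = expR (ln (2 + delta)) by rewrite lnK ?posrE.
by move: H; rewrite {1}E -expRD ler_expR; lra.
Qed.

End hyperbolicity.

(** * Exponentiated Gromov products *)

Section visual.
Context {R : realType} {X : metricType R}.
Implicit Types (o x y z : X).

(** The function exp(-(x|y)_o) on the space itself. *)
Definition vis o x y : R := expR (- gromov_prod o x y).

(** The square root exp(-(x|y)_o / 2) of [vis].  On the diagonal it equals
    exp(-d(o,x)/2), the weight that measures how far [x] is from [o]. *)
Definition hvis o x y : R := expR (- (2^-1 * gromov_prod o x y)).

Lemma gromov_prodC o x y : gromov_prod o x y = gromov_prod o y x.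
Proof. by rewrite /gromov_prod (metric_sym x y); ring. Qed.

Lemma gromov_prod_ge0 o x y : 0 <= gromov_prod o x y.
Proof.
have := metric_triangle x o y; rewrite (metric_sym x o) /gromov_prod; lra.
Qed.

Lemma gromov_prod_lel o x y : gromov_prod o x y <= mdist o x.
Proof. have := metric_triangle o x y; rewrite /gromov_prod; lra. Qed.

Lemma gromov_prod_lip o x y z :
  `|gromov_prod o x z - gromov_prod o y z| <= mdist x y.
Proof.
have := metric_triangle o x y; have := metric_triangle o y x.
have := metric_triangle x y z; have := metric_triangle y x z.
by rewrite (metric_sym y x) ler_norml /gromov_prod => *; apply/andP; split; lra.
Qed.

Lemma gromov_prod_base o o' x y :
  `|gromov_prod o x y - gromov_prod o' x y| <= mdist o o'.
Proof.
have := metric_triangle o' o x; have := metric_triangle o o' x.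
have := metric_triangle o' o y; have := metric_triangle o o' y.
by rewrite (metric_sym o' o) ler_norml /gromov_prod => *; apply/andP; split; lra.
Qed.

Lemma gromov_prod_baser o x : gromov_prod o x o = 0.
Proof. by rewrite /gromov_prod mdistxx (metric_sym x o); ring. Qed.

Lemma visC o x y : vis o x y = vis o y x.
Proof. by rewrite /vis gromov_prodC. Qed.

Lemma vis_gt0 o x y : 0 < vis o x y. Proof. exact: expR_gt0. Qed.

Lemma vis_ge0 o x y : 0 <= vis o x y. Proof. exact: expR_ge0. Qed.

Lemma vis_le1 o x y : vis o x y <= 1.
Proof. by rewrite -expR0 ler_expR oppr_le0 gromov_prod_ge0. Qed.

Lemma vis_baser o x : vis o x o = 1.
Proof. by rewrite /vis gromov_prod_baser oppr0 expR0. Qed.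

Lemma hvis_gt0 o x y : 0 < hvis o x y. Proof. exact: expR_gt0. Qed.

Lemma hvis_ge0 o x y : 0 <= hvis o x y. Proof. exact: expR_ge0. Qed.

Lemma hvis_le1 o x y : hvis o x y <= 1.
Proof.
by rewrite -expR0 ler_expR oppr_le0 mulr_ge0 ?gromov_prod_ge0.
Qed.

Lemma hvisC o x y : hvis o x y = hvis o y x.
Proof. by rewrite /hvis gromov_prodC. Qed.

Lemma hvis_sqr o x y : hvis o x y ^+ 2 = vis o x y.
Proof. by rewrite expr2 -expRD /vis; congr expR; lra. Qed.

Lemma hvis_diag o x : hvis o x x = expR (- (2^-1 * mdist o x)).
Proof. by rewrite /hvis /gromov_prod mdistxx; congr expR; lra. Qed.

Lemma vis_le_hvis o x y : vis o x y <= hvis o x y.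
Proof.
by rewrite ler_expR; have := gromov_prod_ge0 o x y; lra.
Qed.

Lemma hvis_diag_le o x y : hvis o x x <= hvis o x y.
Proof.
by rewrite hvis_diag ler_expR; have := gromov_prod_lel o x y; lra.
Qed.

(** The exponential is 1-Lipschitz on the nonpositive reals, where the opposites
    of Gromov products live. *)
Lemma vis_lip_mdist o x y z : `|vis o x z - vis o y z| <= mdist x y.
Proof.
wlog le_xy : x y / gromov_prod o x z <= gromov_prod o y z => [hw|].
  have [|/ltW] := leP (gromov_prod o x z) (gromov_prod o y z); first exact: hw.
  by move=> /hw; rewrite distrC metric_sym.
have vge : vis o y z <= vis o x z by rewrite ler_expR; lra.
have p0 := gromov_prod_ge0 o x z.
have := gromov_prod_lip o x y z; rewrite ler_norml => /andP[lip _].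
rewrite ger0_norm ?subr_ge0//.
set u := gromov_prod o x z in p0 le_xy lip.
set v := gromov_prod o y z in le_xy lip.
have e1 : 1 + (u - v) <= expR (u - v) by exact: expR_ge1Dx.
have -> : vis o y z = vis o x z * expR (u - v).
  by rewrite -expRD; congr expR; rewrite /u /v; lra.
have := vis_gt0 o x z; have := vis_le1 o x z.
set w := vis o x z => *; nra.
Qed.

Variable (delta : R).
Hypothesis PT : asymptotically_PT_with X delta.

(** The asymptotic PT_{-1} inequality multiplied by
    exp(-(d(o,x1) + ... + d(o,x4))/2): an approximate Ptolemy inequality for
    [vis].  After this rescaling the term of the maximum given by a distance
    d(xi,xj) is [vis o xi xj] times the weights of the other two points. *)
Lemma vis_quad o x1 x2 x3 x4 (E : R) :
  let h z := hvis o z z in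
  vis o x1 x2 * h x3 * h x4 <= E -> vis o x1 x3 * h x2 * h x4 <= E ->
  vis o x1 x4 * h x2 * h x3 <= E -> vis o x2 x3 * h x1 * h x4 <= E ->
  vis o x2 x4 * h x1 * h x3 <= E -> vis o x3 x4 * h x1 * h x2 <= E ->
  vis o x1 x3 * vis o x2 x4 <=
    vis o x1 x2 * vis o x3 x4 + vis o x1 x4 * vis o x2 x3 + delta * E.
Proof.
move=> /=; rewrite !hvis_diag -!expRD => E12 E13 E14 E23 E24 E34.
have [d0 /(_ x1 x2 x3 x4) /=] := PT.
set rho := \big[_/_]_(_ <- _) _.
pose S := mdist o x1 + mdist o x2 + mdist o x3 + mdist o x4.
rewrite -(ler_pM2r (expR_gt0 (- (2^-1 * S)))) !mulrDl -mulrA -!expRD => H.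
have Erho : expR (2^-1 * rho - 2^-1 * S) <= E.
  have Emax (a b : R) : expR (2^-1 * a - 2^-1 * S) <= E ->
      expR (2^-1 * b - 2^-1 * S) <= E ->
      expR (2^-1 * Num.max a b - 2^-1 * S) <= E.
    by case: (leP a b).
  have p12 := mdist_ge0 x1 x2.
  rewrite /rho !big_cons big_nil.
  (* The default value 0 of the maximum is dominated by any distance. *)
  have E0 : expR (2^-1 * 0 - 2^-1 * S) <= E.
    by apply: le_trans E12; rewrite ler_expR /gromov_prod /S; lra.
  apply: (Emax); [apply: le_trans E12|apply: (Emax); [apply: le_trans E13|
    apply: (Emax); [apply: le_trans E14|apply: (Emax); [apply: le_trans E23|
    apply: (Emax); [apply: le_trans E24|apply: (Emax); [apply: le_trans E34|
    exact: E0]]]]]]; rewrite ler_expR /gromov_prod /S; lra.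
apply: le_trans (le_trans H _).
  by rewrite ler_expR /gromov_prod /S; lra.
apply: lerD; last by rewrite ler_pM2l.
by apply: lerD; rewrite ler_expR /gromov_prod /S; lra.
Qed.

Lemma mulr3_le (a b c E : R) : 0 <= a <= 1 -> 0 <= b <= 1 -> 0 <= c <= 1 ->
  Num.min a (Num.min b c) <= E -> a * b * c <= E.
Proof.
move=> /andP[? ?] /andP[? ?] /andP[? ?]; apply: le_trans.
rewrite !le_min; apply/and3P; split.
- by rewrite -mulrA ler_piMr// mulr_ile1.
- by rewrite mulrAC ler_piMl// mulr_ile1.
- by rewrite ler_piMl ?mulr_ile1.
Qed.

Lemma vis01 o x y : 0 <= vis o x y <= 1.
Proof. by rewrite ltW ?vis_gt0 ?vis_le1. Qed.

Lemma hvis01 o x y : 0 <= hvis o x y <= 1.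
Proof. by rewrite ltW ?hvis_gt0 ?hvis_le1. Qed.

(** Taking [o] as fourth point in [vis_quad], where [vis o _ o = 1].  Every
    error term contains one of the factors exp(-d(o,z)/2), exp(-d(o,y)/2) and
    exp(-(z|y)_o), which are at most exp(-(z|y)_o / 2) since (z|y)_o is
    nonnegative and bounded by both d(o,z) and d(o,y). *)
Lemma vis_triangle_hvis o x y z :
  vis o x y <= vis o x z + (1 + delta) * hvis o z y.
Proof.
have hz : hvis o z z <= hvis o z y := hvis_diag_le o z y.
have hy : hvis o y y <= hvis o z y by rewrite hvisC hvis_diag_le.
have s := vis_le_hvis o z y.
suff : vis o x y * vis o z o <= vis o x z * vis o y o + vis o x o * vis o z y +
    delta * hvis o z y.
  by rewrite !vis_baser; lra.
apply: (@vis_quad o x z y o); (apply: mulr3_le;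
  [exact: vis01|exact: hvis01|exact: hvis01|rewrite !ge_min]);
  by apply/or3P; rewrite ?hz ?hy ?s; constructor.
Qed.

(** The key estimate: points with a large Gromov product are nearly
    indistinguishable by [vis o _ z], uniformly in [z]. *)
Lemma vis_lip_hvis o x y z :
  `|vis o x z - vis o y z| <= (1 + delta) * hvis o x y.
Proof.
have := vis_triangle_hvis o z x y; have := vis_triangle_hvis o z y x.
rewrite !(visC o z) (hvisC o y x) => *.
by rewrite ler_norml; apply/andP; split; lra.
Qed.

(** When all the points go to infinity the error terms of this lemma and of the
    next one vanish. *)
Lemma vis_ptolemy_far o x1 x2 x3 x4 :
  vis o x1 x3 * vis o x2 x4 <=
    vis o x1 x2 * vis o x3 x4 + vis o x1 x4 * vis o x2 x3
    + delta * (hvis o x1 x1 + hvis o x2 x2 + hvis o x3 x3 + hvis o x4 x4).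
Proof.
have h z : 0 <= hvis o z z by exact/ltW/hvis_gt0.
have := h x1; have := h x2; have := h x3; have := h x4 => *.
apply: (@vis_quad o x1 x2 x3 x4); (apply: mulr3_le;
  [exact: vis01|exact: hvis01|exact: hvis01|rewrite !ge_min]);
  by apply/orP; right; apply/orP; left; lra.
Qed.

Lemma vis_triangle_far o x y z :
  vis o x z <= vis o x y + vis o y z
    + delta * (hvis o x x + hvis o y y + hvis o z z).
Proof.
suff : vis o x z * vis o y o <= vis o x y * vis o z o + vis o x o * vis o y z +
    delta * (hvis o x x + hvis o y y + hvis o z z).
  by rewrite !vis_baser; lra.
have h w : 0 <= hvis o w w by exact/ltW/hvis_gt0.
have := h x; have := h y; have := h z => *.
apply: (@vis_quad o x y z o); (apply: mulr3_le;
  [exact: vis01|exact: hvis01|exact: hvis01|rewrite !ge_min]);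
  by apply/orP; right; apply/orP; left; lra.
Qed.

End visual.

(** * Limits of real sequences *)

Section real_limits.
Context {R : realType}.

Lemma cvgry_expRN {T : Type} {F : set_system T} {FF : Filter F} (f : T -> R) :
  f x @[x --> F] --> +oo <->
  forall e, 0 < e -> \forall x \near F, expR (- f x) <= e.
Proof.
rewrite cvgryPge; split=> [H e e0|H A].
  apply: filterS (H (- ln e)) => x fx.
  by rewrite -[leRHS]lnK ?posrE// ler_expR; lra.
apply: filterS (H (expR (- A)) (expR_gt0 _)) => x.
by rewrite ler_expR lerN2.
Qed.

Lemma near_oo2P (P : nat -> nat -> Prop) :
  (\forall ij \near (\oo, \oo), P ij.1 ij.2) <->
  exists N, forall i j, (N <= i)%N -> (N <= j)%N -> P i j.
Proof.
split=> [[[A B] [[N _ NA] [M _ MB]] AB]|[N HN]].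
  exists (maxn N M) => i j; rewrite !geq_max => /andP[Ni Mi] /andP[Nj Mj].
  by apply: (AB (i, j)); split => /=; [exact: NA|exact: MB].
exists ([set i | (N <= i)%N], [set i | (N <= i)%N]); first by split; exists N.
by move=> [i j] [/= Ni Nj]; exact: HN.
Qed.

Lemma cauchy_real_cvg (u : nat -> R) :
  (forall e, 0 < e -> exists N, forall i j, (N <= i)%N -> (N <= j)%N ->
    `|u i - u j| <= e) ->
  exists l : R, u n @[n --> \oo] --> l.
Proof.
move=> cu; suff : cvgn u by move=> ?; exists (limn u).
apply/cauchy_cvgP/cauchy_exP => e e0.
have e20 : 0 < e / 2 by lra.
have [N HN] := cu _ e20; exists (u N); exists N => // n /= Nn.
by rewrite /ball/=; apply: le_lt_trans (HN N n _ _) _ => //; lra.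
Qed.

(** The limit may be 0: then [lne l%:E] is [-oo]. *)
Lemma cvg_lneN (u : nat -> R) (l : R) :
  u n @[n --> \oo] --> l -> (forall n, 0 < u n) ->
  (- ln (u n))%:E @[n --> \oo] --> (- lne l%:E)%E.
Proof.
move=> ul u0.
have l0 : 0 <= l.
  apply: cvgr_to_ge ul _; apply: nearW => n; exact/ltW/u0.
rewrite /lne /=; case: leP => [l_le0|lgt0]; last first.
  apply: cvg_EFin; first by near=> n.
  by apply: cvgN; exact: (cvg_comp u (@ln R) ul (continuous_ln lgt0)).
have {l_le0} l_eq0 : l = 0 by apply/eqP; rewrite eq_le l_le0.
apply/cvgeyPge => A; rewrite l_eq0 in ul.
move/cvgrPdist_le : ul => /(_ _ (expR_gt0 (- A))) H.
apply: filterS H => n; rewrite sub0r normrN (ger0_norm (ltW (u0 n))).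
by rewrite -{1}[u n]lnK ?posrE// ler_expR lee_fin lerNr.
Unshelve. all: by end_near. Qed.

Lemma harmonic_small (c e : R) : 0 < e ->
  exists N, forall n, (N <= n)%N -> c * n.+1%:R^-1 <= e.
Proof.
move=> e0; have : c * harmonic n @[n --> \oo] --> c * 0.
  by apply: cvgMr; exact: cvg_harmonic.
rewrite mulr0 => /cvgrPdist_le/(_ _ e0) [N _ HN]; exists N => n Nn.
by have /= := HN n Nn; rewrite sub0r normrN => /(le_trans (ler_norm _)).
Qed.

End real_limits.

(** * Limits of Gromov products at infinity *)

Section boundary_limits.
Context {R : realType} {X : metricType R}.
Implicit Types (o : X) (x y z : nat -> X) (xi zeta : boundary X).

(** Convergence and equivalence at infinity do not depend on the basepoint, since
    changing it moves Gromov products by a bounded amount. *)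
Lemma cvg_at_infinityP o x : cvg_at_infinity x <->
  forall e, 0 < e -> exists N, forall i j, (N <= i)%N -> (N <= j)%N ->
    vis o (x i) (x j) <= e.
Proof.
have P o' : gromov_prod o' (x ij.1) (x ij.2) @[ij --> (\oo, \oo)] --> +oo <->
    forall e, 0 < e -> exists N, forall i j, (N <= i)%N -> (N <= j)%N ->
      vis o' (x i) (x j) <= e.
  split => [/cvgry_expRN H e e0|H].
    by apply/(near_oo2P (fun i j => vis o' (x i) (x j) <= e)); exact: H.
  apply/cvgry_expRN => e e0.
  exact/(near_oo2P (fun i j => vis o' (x i) (x j) <= e))/H.
rewrite -P; split => [[b /cvgryPge H]|]; last by exists o.
apply/cvgryPge => A; apply: filterS (H (A + mdist b o)) => ij.
by have := gromov_prod_base b o (x ij.1) (x ij.2); rewrite ler_norml; lra.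
Qed.

Lemma equiv_at_infinityP o x y : equiv_at_infinity x y <->
  vis o (x i) (y i) @[i --> \oo] --> 0.
Proof.
have P o' : gromov_prod o' (x i) (y i) @[i --> \oo] --> +oo <->
    vis o' (x i) (y i) @[i --> \oo] --> 0.
  have N i : `|0 - vis o' (x i) (y i)| = vis o' (x i) (y i).
    by rewrite sub0r normrN ger0_norm// vis_ge0.
  split => [/cvgry_expRN H|/cvgrPdist_le H].
    by apply/cvgrPdist_le => e e0; apply: filterS (H e e0) => i; rewrite N.
  by apply/cvgry_expRN => e e0; apply: filterS (H e e0) => i; rewrite N.
rewrite -P; split => [[b /cvgryPge H]|]; last by exists o.
apply/cvgryPge => A; apply: filterS (H (A + mdist b o)) => i.
by have := gromov_prod_base b o (x i) (y i); rewrite ler_norml; lra.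
Qed.

Lemma hvis_le o (a b : X) e : 0 <= e -> vis o a b <= e ^+ 2 -> hvis o a b <= e.
Proof. by move=> e0; rewrite -hvis_sqr ler_sqr// nnegrE hvis_ge0. Qed.

Lemma equiv_at_infinity_sym x y : equiv_at_infinity x y -> equiv_at_infinity y x.
Proof.
by move=> [b H]; exists b; under eq_fun do rewrite gromov_prodC.
Qed.

Lemma cvg_at_infinity_refl x : cvg_at_infinity x -> equiv_at_infinity x x.
Proof.
move=> [b H]; exists b.
apply: (@cvg_comp _ _ _ (fun i : nat => (i, i)) _ _ _ _ _ H).
exact: cvg_pair.
Qed.

Lemma boundary_rep xi : exists2 x, sval xi x & sval xi = class_at_infinity x.
Proof.
case: xi => S [x cx Sx] /=; exists x => //; rewrite Sx; split => //.
exact: cvg_at_infinity_refl.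
Qed.

Lemma boundary_cvg xi x : sval xi x -> cvg_at_infinity x.
Proof. by have [y _ ->] := boundary_rep xi; case. Qed.

Lemma boundary_inj xi zeta : sval xi = sval zeta -> xi = zeta.
Proof.
case: xi zeta => [S pS] [T pT] /= ST; subst T; congr exist.
exact: Prop_irrelevance.
Qed.

Lemma cvg_to_point_ex (p : X + boundary X) : exists x, cvg_to_point x p.
Proof.
case: p => [a|xi]; first by exists (fun=> a); exact: cvg_cst.
by have [x ? _] := boundary_rep xi; exists x.
Qed.

Lemma hvis_diag_cvg0 o x : cvg_at_infinity x ->
  hvis o (x i) (x i) @[i --> \oo] --> 0.
Proof.
move=> /(cvg_at_infinityP o) cx; apply/cvgrPdist_le => e e0.
have [|N HN] := cx (e ^+ 2); first by rewrite exprn_gt0.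
exists N => // i /= Ni; rewrite sub0r normrN ger0_norm ?hvis_ge0//.
by apply: hvis_le; [exact: ltW|exact: HN].
Qed.

Variable delta : R.
Hypothesis PT : asymptotically_PT_with X delta.

Let delta_gt0 : 0 < 1 + delta. Proof. by case: PT => *; lra. Qed.

Lemma equiv_at_infinity_trans x y z : equiv_at_infinity x y ->
  equiv_at_infinity y z -> equiv_at_infinity x z.
Proof.
case=> o; rewrite -/(equiv_at_infinity x y) => xy yz.
have /(equiv_at_infinityP o)/cvgrPdist_le {}xy : equiv_at_infinity x y by exists o.
move/(equiv_at_infinityP o)/cvgrPdist_le : yz => yz.
apply/(equiv_at_infinityP o)/cvgrPdist_le => e e0.
have c0 := delta_gt0; set c := 1 + delta in c0.
have e20 : 0 < e / 2 by lra.
have ec0 : 0 < e / 2 / c by rewrite divr_gt0.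
near=> i.
rewrite sub0r normrN ger0_norm ?vis_ge0//.
apply: (le_trans (vis_triangle_hvis PT o _ _ (y i))).
have H1 : vis o (x i) (y i) <= e / 2.
  rewrite -(ger0_norm (vis_ge0 _ _ _)) -normrN -sub0r.
  by near: i; exact: xy.
have H2 : hvis o (y i) (z i) <= e / 2 / c.
  apply: hvis_le; first exact: ltW.
  rewrite -(ger0_norm (vis_ge0 _ _ _)) -normrN -sub0r.
  by near: i; apply: yz; rewrite exprn_gt0.
rewrite (splitr e); apply: lerD => //.
by rewrite mulrC -ler_pdivlMr.
Unshelve. all: by end_near. Qed.

Lemma class_at_infinity_eq x y : equiv_at_infinity x y ->
  class_at_infinity x = class_at_infinity y.
Proof.
move=> xy; apply/seteqP; split => z [cz xz]; split => //.
  exact: equiv_at_infinity_trans (equiv_at_infinity_sym xy) xz.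
exact: equiv_at_infinity_trans xy xz.
Qed.

Lemma boundary_equiv xi x y : sval xi x -> sval xi y -> equiv_at_infinity x y.
Proof.
have [z _ ->] := boundary_rep xi => -[_ zx] [_ zy].
exact: equiv_at_infinity_trans (equiv_at_infinity_sym zx) zy.
Qed.

(** Two sequences with the same limit in the bordification eventually define
    nearly the same function [vis o _ a], uniformly in [a].  This treats limits
    in the space and limits at infinity on the same footing. *)
Lemma vis_uniform o (p : X + boundary X) x y :
  cvg_to_point x p -> cvg_to_point y p ->
  forall e, 0 < e -> exists N, forall i j, (N <= i)%N -> (N <= j)%N ->
    forall a, `|vis o (x i) a - vis o (y j) a| <= e.
Proof.
case: p => [b|xi] /= xp yp e e0.
  have e20 : 0 < e / 2 by lra.
  have [N1 _ H1] := metricType_numDomainType.cvgr_dist_le xp e20.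
  have [N2 _ H2] := metricType_numDomainType.cvgr_dist_le yp e20.
  exists (maxn N1 N2) => i j; rewrite !geq_max => /andP[i1 _] /andP[_ j2] a.
  apply: le_trans (vis_lip_mdist _ _ _ _) _.
  apply: le_trans (metric_triangle _ b _) _; rewrite metric_sym (splitr e).
  by apply: lerD; [exact: H1|exact: H2].
have /(equiv_at_infinityP o)/cvgrPdist_le xy := boundary_equiv xp yp.
have /(cvg_at_infinityP o) cx := boundary_cvg xp.
have c0 := delta_gt0; set c := 1 + delta in c0.
(* By [vis_lip_hvis] it suffices that [hvis o (x i) (y j)] is at most [e / c], that
   is, that its square is at most [2 * e1]; the latter is compared with
   [vis o (x j) (y j)] by [vis_triangle_hvis]. *)
pose e1 := (e / c) ^+ 2 / 2; have ec0 : 0 < e / c by rewrite divr_gt0.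
have e10 : 0 < e1 by rewrite divr_gt0// exprn_gt0.
have [N1 _ H1] := xy _ e10.
have [|N2 H2] := cx ((e1 / c) ^+ 2); first by rewrite exprn_gt0// divr_gt0.
exists (maxn N1 N2) => i j; rewrite !geq_max => /andP[_ i2] /andP[j1 j2] a.
apply: le_trans (vis_lip_hvis PT _ _ _ _) _.
rewrite mulrC -ler_pdivlMr//; apply: hvis_le; first exact: ltW.
rewrite visC; apply: le_trans (vis_triangle_hvis PT _ _ _ (x j)) _.
have := H1 j j1; rewrite sub0r normrN ger0_norm ?vis_ge0// visC => ?.
have -> : (e / c) ^+ 2 = e1 + e1 by rewrite /e1; lra.
apply: lerD => //; rewrite mulrC -ler_pdivlMr//.
by apply: hvis_le; [exact/ltW/divr_gt0|exact: H2].
Qed.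

Lemma vis_cauchy o (p q : X + boundary X) x x' y y' :
  cvg_to_point x p -> cvg_to_point x' p ->
  cvg_to_point y q -> cvg_to_point y' q ->
  forall e, 0 < e -> exists N, forall i j, (N <= i)%N -> (N <= j)%N ->
    `|vis o (x i) (y i) - vis o (x' j) (y' j)| <= e.
Proof.
move=> xp xp' yq yq' e e0; have e20 : 0 < e / 2 by lra.
have [N1 H1] := vis_uniform o xp xp' e20.
have [N2 H2] := vis_uniform o yq yq' e20.
exists (maxn N1 N2) => i j; rewrite !geq_max => /andP[i1 i2] /andP[j1 j2].
rewrite (splitr e) -(subrKA (vis o (x' j) (y i))).
apply: le_trans (ler_normD _ _) (lerD (H1 _ _ i1 j1 _) _).
by rewrite !(visC o (x' j)); exact: H2.
Qed.

Lemma vis_cvg_ex o (p q : X + boundary X) : exists l : R,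
  forall x y, cvg_to_point x p -> cvg_to_point y q ->
    vis o (x i) (y i) @[i --> \oo] --> l.
Proof.
have [x0 x0p] := cvg_to_point_ex p; have [y0 y0q] := cvg_to_point_ex q.
have [l x0y0] := cauchy_real_cvg (vis_cauchy o x0p x0p y0q y0q).
exists l => x y xp yq; rewrite -[l]add0r.
under eq_fun => i do rewrite -(subrK (vis o (x0 i) (y0 i)) (vis o (x i) (y i))).
apply: cvgD x0y0; apply/cvgrPdist_le => e e0.
have [N HN] := vis_cauchy o xp x0p yq y0q e0.
by exists N => // i /= Ni; rewrite sub0r normrN; exact: HN.
Qed.

Lemma vis_cvg_gromov o x y l : vis o (x i) (y i) @[i --> \oo] --> l ->
  (gromov_prod o (x i) (y i))%:E @[i --> \oo] --> (- lne l%:E)%E.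
Proof.
move=> /cvg_lneN H; have {H} := H (fun _ => vis_gt0 _ _ _).
by under eq_fun do rewrite expRK opprK.
Qed.

(** Since [vis o (x i) (y i)] converges to a number [l] that depends only on the
    limits of [x] and [y], the infimum of lower limits which defines
    [egromov_prod] ranges over a single value, [- ln l], that is [+oo] if
    [l = 0]. *)
Lemma egromov_prod_spec o (p q : X + boundary X) : exists2 l : R,
  0 <= l /\ egromov_prod o p q = (- lne l%:E)%E &
  forall x y, cvg_to_point x p -> cvg_to_point y q ->
    vis o (x i) (y i) @[i --> \oo] --> l.
Proof.
have [l Hl] := vis_cvg_ex o p q; exists l => //.
have [x0 x0p] := cvg_to_point_ex p; have [y0 y0q] := cvg_to_point_ex q.
split.
  by apply: cvgr_to_ge (Hl _ _ x0p y0q) _; apply: nearW => n; exact: vis_ge0.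
have liminf x y : cvg_to_point x p -> cvg_to_point y q ->
    limn_einf (fun i => (gromov_prod o (x i) (y i))%:E) = (- lne l%:E)%E.
  move=> xp yq; have /vis_cvg_gromov := Hl _ _ xp yq.
  by move=> /cvg_limn_einf_sup[].
have cst a : cvg_to_point (fun=> a) (inl a : X + boundary X) by exact: cvg_cst.
case: p q x0p y0q {Hl} liminf => [a|xi] [b|zeta] /= x0p y0q liminf.
- rewrite -(liminf _ _ (cst a) (cst b)); apply/esym.
  apply: (cvg_limn_einf_sup _).1; exact: cvg_cst.
all: rewrite -[RHS]ereal_inf1; congr ereal_inf; apply/seteqP; split => r /=.
- by move=> [y yz <-]; apply: liminf => //; exact: cst.
- by move=> ->; exists y0 => //; apply: liminf => //; exact: cst.
- by move=> [x xz <-]; apply: liminf => //; exact: cst.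
- by move=> ->; exists x0 => //; apply: liminf => //; exact: cst.
- by move=> [x xz [y yz <-]]; apply: liminf => //; exact: cst.
- by move=> ->; exists x0 => //; exists y0 => //; apply: liminf => //; exact: cst.
Qed.

(** The extension of [vis] to the bordification.  Its values are real numbers: the
    argument of [fine] is finite by [egromov_prod_spec]. *)
Definition bvis o (p q : X + boundary X) : R :=
  fine (expeR (- egromov_prod o p q)).

Lemma expeR_egromov_prod o (p q : X + boundary X) :
  expeR (- egromov_prod o p q) = (bvis o p q)%:E.
Proof.
have [l [l0 E] _] := egromov_prod_spec o p q.
have {}E : expeR (- egromov_prod o p q) = l%:E.
  by rewrite E oppeK; apply/eqP; rewrite lneK_eq lee_fin.
by rewrite /bvis E.
Qed.

Lemma bvis_cvg o (p q : X + boundary X) x y :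
  cvg_to_point x p -> cvg_to_point y q ->
  vis o (x i) (y i) @[i --> \oo] --> bvis o p q.
Proof.
have [l [l0 E] H] := egromov_prod_spec o p q.
have -> : bvis o p q = l; last exact: H.
apply: EFin_inj; rewrite -expeR_egromov_prod E oppeK.
by apply/eqP; rewrite lneK_eq lee_fin.
Qed.

Lemma boundary_continuous_of_PT : boundary_continuous X.
Proof.
move=> x y p q xp yq o; have [l [_ ->] H] := egromov_prod_spec o p q.
exact/vis_cvg_gromov/H.
Qed.

End boundary_limits.

(** * Moebius equivalence of extended metrics *)

Section moebius_equivalence.
Context {R : realType} {Z : Type}.
Implicit Types d : Z -> Z -> \bar R.

Lemma moebius_equivalent_refl d : moebius_equivalent d d.
Proof.
split=> [//|x y z w _]; exists 1; first exact: oner_neq0.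
by rewrite !mul1r; case: crt => [[]].
Qed.

Lemma moebius_equivalent_sym d1 d2 :
  moebius_equivalent d1 d2 -> moebius_equivalent d2 d1.
Proof.
move=> [_ H]; split=> [//|x y z w /H [k k0 /= ->]].
exists k^-1; first by rewrite invr_eq0.
by rewrite /= !mulKf.
Qed.

Lemma moebius_equivalent_trans d1 d2 d3 : moebius_equivalent d1 d2 ->
  moebius_equivalent d2 d3 -> moebius_equivalent d1 d3.
Proof.
move=> [_ H] [_ H']; split=> [//|x y z w adm].
have [k k0 E] := H _ _ _ _ adm; have [k' k'0 E'] := H' _ _ _ _ adm.
by exists (k' * k); [rewrite mulf_neq0|rewrite E' E /= !mulrA].
Qed.

Lemma moebius_class_eq d1 d2 : moebius_equivalent d1 d2 ->
  moebius_class d1 = moebius_class d2.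
Proof.
move=> d12; apply/seteqP; split => d [dext e]; split => //.
  exact: moebius_equivalent_trans (moebius_equivalent_sym d12) e.
exact: moebius_equivalent_trans d12 e.
Qed.

End moebius_equivalence.

(** * The visual metrics on the boundary *)

Section boundary_metric.
Context {R : realType} {X : metricType R}.
Variable delta : R.
Hypothesis PT : asymptotically_PT_with X delta.
Implicit Types (o : X) (x y : nat -> X) (xi zeta : boundary X).

Local Notation D o xi zeta := (bvis o (inr xi) (inr zeta)).

Lemma visual_metricE o xi zeta : visual_metric o xi zeta = (D o xi zeta)%:E.
Proof. exact: (expeR_egromov_prod PT). Qed.

Lemma bvis_cvgr o xi zeta x y : sval xi x -> sval zeta y ->
  vis o (x i) (y i) @[i --> \oo] --> D o xi zeta.
Proof. exact: (@bvis_cvg _ _ _ PT o (inr xi) (inr zeta)). Qed.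

Arguments bvis_cvgr o {xi zeta x y}.

Lemma bvis_ge0 o xi zeta : 0 <= D o xi zeta.
Proof.
have [x x_xi _] := boundary_rep xi; have [y y_zeta _] := boundary_rep zeta.
apply: (cvgr_to_ge (bvis_cvgr o x_xi y_zeta)).
by apply: nearW => i; exact: vis_ge0.
Qed.

Lemma bvis_le1 o xi zeta : D o xi zeta <= 1.
Proof.
have [x x_xi _] := boundary_rep xi; have [y y_zeta _] := boundary_rep zeta.
apply: (cvgr_to_le (bvis_cvgr o x_xi y_zeta)).
by apply: nearW => i; exact: vis_le1.
Qed.

Lemma bvisC o xi zeta : D o xi zeta = D o zeta xi.
Proof.
have [x x_xi _] := boundary_rep xi; have [y y_zeta _] := boundary_rep zeta.
apply: (cvg_unique _ (bvis_cvgr o x_xi y_zeta)); first exact: Rhausdorff.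
rewrite (_ : (fun i => vis o (x i) (y i)) = fun i => vis o (y i) (x i)).
  exact: bvis_cvgr.
by apply/funext => i; exact: visC.
Qed.

Lemma bvis_eq0 o xi zeta : D o xi zeta = 0 <-> xi = zeta.
Proof.
have [x x_xi xiE] := boundary_rep xi.
have [y y_zeta zetaE] := boundary_rep zeta; split => [D0|<-].
  apply: boundary_inj; rewrite xiE zetaE; apply: (class_at_infinity_eq PT).
  by apply/(equiv_at_infinityP o); rewrite -D0; exact: bvis_cvgr.
have /(equiv_at_infinityP o) xx := cvg_at_infinity_refl (boundary_cvg x_xi).
by apply: (cvg_unique _ (bvis_cvgr o x_xi x_xi)) => //; exact: Rhausdorff.
Qed.

Lemma bvis_triangle o xi eta zeta :
  D o xi zeta <= D o xi eta + D o eta zeta.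
Proof.
have [x x_xi _] := boundary_rep xi; have [y y_eta _] := boundary_rep eta.
have [z z_zeta _] := boundary_rep zeta.
have hx := hvis_diag_cvg0 o (boundary_cvg x_xi).
have hy := hvis_diag_cvg0 o (boundary_cvg y_eta).
have hz := hvis_diag_cvg0 o (boundary_cvg z_zeta).
have -> : D o xi eta + D o eta zeta =
    D o xi eta + D o eta zeta + delta * (0 + 0 + 0) by rewrite !addr0 mulr0 addr0.
apply: ler_cvg_to (bvis_cvgr o x_xi z_zeta) _ _; last first.
  by apply: nearW => i; exact: (vis_triangle_far PT o (x i) (y i) (z i)).
apply: cvgD; first by apply: cvgD; exact: bvis_cvgr.
by apply: cvgMr; apply: cvgD hz; exact: cvgD.
Qed.

Lemma bvis_ptolemy o xi1 xi2 xi3 xi4 :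
  D o xi1 xi3 * D o xi2 xi4 <=
    D o xi1 xi2 * D o xi3 xi4 + D o xi1 xi4 * D o xi2 xi3.
Proof.
have [x1 p1 _] := boundary_rep xi1; have [x2 p2 _] := boundary_rep xi2.
have [x3 p3 _] := boundary_rep xi3; have [x4 p4 _] := boundary_rep xi4.
have h1 := hvis_diag_cvg0 o (boundary_cvg p1).
have h2 := hvis_diag_cvg0 o (boundary_cvg p2).
have h3 := hvis_diag_cvg0 o (boundary_cvg p3).
have h4 := hvis_diag_cvg0 o (boundary_cvg p4).
rewrite -[leRHS]addr0 -(mulr0 delta) -[X in delta * X](addr0 0).
rewrite -[X in delta * (X + _)](addr0 0) -[X in delta * (X + _ + _)](addr0 0).
apply: ler_cvg_to (cvgM (bvis_cvgr o p1 p3) (bvis_cvgr o p2 p4)) _ _; last first.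
  apply: nearW => i; exact: (vis_ptolemy_far PT o (x1 i) (x2 i) (x3 i) (x4 i)).
apply: cvgD; first by apply: cvgD; apply: cvgM; exact: bvis_cvgr.
by apply: cvgMr; apply: cvgD h4; apply: cvgD h3; exact: cvgD.
Qed.

Lemma visual_metric_metric o : metric_on [set: boundary X] (visual_metric o).
Proof.
split=> [xi zeta _ _|xi zeta _ _|xi zeta _ _|xi eta zeta _ _ _];
  rewrite !visual_metricE.
- by split => //; rewrite lee_fin bvis_ge0.
- by rewrite -(bvis_eq0 o); split => [[]|->].
- by rewrite bvisC.
- by rewrite -EFinD lee_fin bvis_triangle.
Qed.

Lemma visual_metric_ext o : ext_metric_with set0 (visual_metric o).
Proof. by split => //; rewrite setC0; exact: visual_metric_metric. Qed.

Lemma crt_visual_metric o xi1 xi2 xi3 xi4 :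
  crt (visual_metric o) xi1 xi2 xi3 xi4 =
    (D o xi1 xi2 * D o xi3 xi4, D o xi1 xi3 * D o xi2 xi4,
     D o xi1 xi4 * D o xi2 xi3).
Proof. by rewrite /crt /cancelled_dist !visual_metricE. Qed.

Lemma visual_metric_ptolemaic o : ptolemaic_ext_metric (visual_metric o).
Proof.
move=> x1 x2 x3 x4 _; rewrite crt_visual_metric; split.
- by have := bvis_ptolemy o x1 x3 x2 x4; rewrite (bvisC o x3 x2).
- by have := bvis_ptolemy o x1 x2 x3 x4.
- by have := bvis_ptolemy o x1 x2 x4 x3; rewrite (bvisC o x4 x3).
Qed.

Lemma vis_change_base o o' (a b : X) :
  vis o a b = vis o' a b * (vis o o' a * vis o o' b * expR (mdist o o')).
Proof.
by rewrite /vis -!expRD; congr expR; rewrite /gromov_prod; lra.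
Qed.

(** The Gromov product of [o'] with a boundary point is finite. *)
Lemma bvis_base_gt0 o o' xi : 0 < bvis o (inl o') (inr xi).
Proof.
have [x x_xi _] := boundary_rep xi; apply: lt_le_trans (expR_gt0 (- mdist o o')) _.
have co' : cvg_to_point (fun=> o') (inl o' : X + boundary X) by exact: cvg_cst.
apply: (cvgr_to_ge (@bvis_cvg _ _ _ PT o _ (inr xi) _ _ co' x_xi)).
by apply: nearW => i; rewrite ler_expR lerN2 gromov_prod_lel.
Qed.

(** The visual metrics for [o] and [o'] differ by a factor which is a product of a
    function of each of the two points: such a factor cancels in cross ratios. *)
Lemma bvis_change_base o o' xi zeta :
  D o xi zeta = D o' xi zeta *
    (bvis o (inl o') (inr xi) * bvis o (inl o') (inr zeta) * expR (mdist o o')).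
Proof.
have [x x_xi _] := boundary_rep xi; have [y y_zeta _] := boundary_rep zeta.
have co' : cvg_to_point (fun=> o') (inl o' : X + boundary X) by exact: cvg_cst.
apply: (cvg_unique _ (bvis_cvgr o x_xi y_zeta)); first exact: Rhausdorff.
rewrite (_ : (fun i => vis o (x i) (y i)) = fun i => vis o' (x i) (y i) *
  (vis o o' (x i) * vis o o' (y i) * expR (mdist o o'))); last first.
  by apply/funext => i; exact: vis_change_base.
apply: cvgM; first exact: bvis_cvgr.
apply: cvgM; last exact: cvg_cst.
apply: cvgM.
  exact: (@bvis_cvg _ _ _ PT o _ (inr xi) _ _ co' x_xi).
exact: (@bvis_cvg _ _ _ PT o _ (inr zeta) _ _ co' y_zeta).
Qed.

Lemma visual_metric_moebius o o' :
  moebius_equivalent (@visual_metric R X o) (@visual_metric R X o').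
Proof.
split=> [//|x1 x2 x3 x4 _]; rewrite !crt_visual_metric /=.
pose f xi := bvis o (inl o') (inr xi).
have f0 xi : f xi != 0 by rewrite gt_eqF ?bvis_base_gt0.
have e0 : expR (mdist o o') != 0 by rewrite gt_eqF ?expR_gt0.
exists (f x1 * f x2 * f x3 * f x4 * expR (mdist o o') ^+ 2)^-1.
  by rewrite invr_eq0 !mulf_neq0 ?f0 ?expf_neq0.
rewrite !(bvis_change_base o o') -!/(f _) /=.
by congr (_, _, _); field; rewrite !f0 e0.
Qed.

(** A Cauchy sequence of boundary points converges: choose in a sequence [x n]
    representing the [n]-th point an entry [w n] so far out that [vis o (w n)] is
    within a multiple of 1/(n+1) of [vis o (x n j)] for all large [j].  Then [w]
    converges at infinity, and its class is the limit. *)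
Lemma bvis_complete o (u : nat -> boundary X) :
  (forall e, 0 < e -> exists N, forall i j, (N <= i)%N -> (N <= j)%N ->
    D o (u i) (u j) <= e) ->
  exists xi, forall e, 0 < e ->
    exists N, forall n, (N <= n)%N -> D o (u n) xi <= e.
Proof.
move=> cu; have [delta0 _] := PT.
have /choice[x x_u] : forall n, exists y : nat -> X, sval (u n) y.
  by move=> n; have [y ? _] := boundary_rep (u n); exists y.
have /choice[k Hk] : forall n, exists K, forall i j, (K <= i)%N -> (K <= j)%N ->
    hvis o (x n i) (x n j) <= n.+1%:R^-1.
  move=> n; have /(cvg_at_infinityP o) cx := boundary_cvg (x_u n).
  have [|K HK] := cx (n.+1%:R^-1 ^+ 2); first by rewrite exprn_gt0.
  by exists K => i j Ki Kj; apply: hvis_le => //; exact: HK.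
pose w n := x n (k n); pose eps n : R := (1 + delta) * n.+1%:R^-1.
have wx n a j : (k n <= j)%N -> `|vis o (w n) a - vis o (x n j) a| <= eps n.
  move=> kj; apply: le_trans (vis_lip_hvis PT _ _ _ _) _.
  by rewrite ler_pM2l ?Hk//; lra.
have eps_small e : 0 < e -> exists N, forall n, (N <= n)%N -> eps n <= e.
  exact: harmonic_small.
have ww n m : vis o (w n) (w m) <= D o (u n) (u m) + (eps n + eps m).
  rewrite -lerBlDr; apply: (cvgr_to_ge (bvis_cvgr o (x_u n) (x_u m))).
  exists (maxn (k n) (k m)) => // j /=; rewrite geq_max => /andP[nj mj].
  have := wx n (w m) j nj; have := wx m (x n j) j mj.
  rewrite !(visC o _ (x n j)) !ler_norml => /andP[_ ?] /andP[_ ?]; lra.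
have cw : forall e, 0 < e -> exists N, forall i j, (N <= i)%N -> (N <= j)%N ->
    vis o (w i) (w j) <= e.
  move=> e e0; have e30 : 0 < e / 3 by lra.
  have [N1 H1] := cu _ e30; have [N2 H2] := eps_small _ e30.
  exists (maxn N1 N2) => i j; rewrite !geq_max => /andP[i1 i2] /andP[j1 j2].
  have := ww i j; have := H1 i j i1 j1; have := H2 i i2; have := H2 j j2.
  lra.
have w_cvg : cvg_at_infinity w by exact/(cvg_at_infinityP o).
pose xi : boundary X := exist _ (class_at_infinity w) (ex_intro2 _ _ w w_cvg erefl).
have w_xi : sval xi w by split => //; exact: cvg_at_infinity_refl.
exists xi => e e0; have e20 : 0 < e / 2 by lra.
have [N1 H1] := cw _ e20; have [N2 H2] := eps_small _ e20.
exists (maxn N1 N2) => n; rewrite geq_max => /andP[n1 n2].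
apply: (cvgr_to_le (bvis_cvgr o (x_u n) w_xi)).
exists (maxn (k n) N1) => // m /=; rewrite geq_max => /andP[km m1].
have := wx n (w m) m km; have := H1 n m n1 m1; have := H2 n n2.
by rewrite ler_norml => ? ? /andP[? _]; lra.
Qed.

Lemma visual_metric_complete o : complete_ext_metric (@visual_metric R X o).
Proof.
exists set0; first exact: visual_metric_ext.
split=> [u _ cu|unbounded]; last first.
  exfalso; apply: unbounded; exists 1 => xi zeta _ _.
  by rewrite visual_metricE lee_fin bvis_le1.
have [e e0|xi Hxi] := @bvis_complete o u.
  apply/(near_oo2P (fun i j => D o (u i) (u j) <= e)).
  apply: filterS (cu _ e0) => ij.
  by rewrite visual_metricE lte_fin => /ltW.
exists xi => //; under eq_fun do rewrite visual_metricE.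
apply: cvg_EFin; first exact: nearW.
apply/cvgrPdist_le => e e0; have [N HN] := Hxi _ e0.
by exists N => // n /= Nn; rewrite sub0r normrN ger0_norm ?bvis_ge0//; exact: HN.
Qed.

End boundary_metric.

Theorem theorem1p2 (R : realType) (X : metricType R) :
  asymptotically_PT X ->
  [/\ gromov_hyperbolic X,
      boundary_continuous X,
      forall o : X, metric_on [set: boundary X] (visual_metric o),
      forall o o' : X,
        moebius_equivalent (@visual_metric R X o) (@visual_metric R X o') &
      at_least_two_points (boundary X) ->
      exists M : set (boundary X -> boundary X -> \bar R),
        [/\ moebius_structure M,
            forall o : X, M = moebius_class (@visual_metric R X o),
            complete_moebius M &
            ptolemaic_moebius M]].
Proof.
move=> aPT; have [delta delta0 PT0] := aPT.
have PT : asymptotically_PT_with X delta by split.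
split=> [||||two].
- exact: asymptotically_PT_hyperbolic.
- exact: (boundary_continuous_of_PT PT).
- exact: (visual_metric_metric PT).
- exact: (visual_metric_moebius PT).
have [z _] := two; have [x _ _] := boundary_rep z; pose o := x 0%N.
have Mo : moebius_class (@visual_metric R X o) (@visual_metric R X o).
  split; last exact: moebius_equivalent_refl.
  by exists set0; exact: (visual_metric_ext PT).
exists (moebius_class (@visual_metric R X o)); split.
- by split=> //; exists (@visual_metric R X o) => //; case: Mo.
- by move=> o'; apply: moebius_class_eq; exact: (visual_metric_moebius PT).
- by exists (@visual_metric R X o) => //; exact: (visual_metric_complete PT).
- by exists (@visual_metric R X o) => //; exact: (visual_metric_ptolemaic PT).
Qed.
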